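(* The Penalized Knapsack Problem with $n$ items and capacity $c$ can be solved to optimality in $O(\max\{nc,\,n\log n\})$ time.
   Context: The Penalized Knapsack Problem (PKP): given $n$ items with non-negative integer profits $p_j$, weights $w_j$, penalties $\pi_j$ and a non-negative integer capacity $c$, choose $x\in\{0,1\}^n$ with $\sum_j w_jx_j\le c$ maximizing $\sum_j p_jx_j-\max\{\pi_j:x_j=1\}$ (the maximum over the empty set being $0$). *)

(* Defs.v *)
From mathcomp Require Import all_boot all_order all_algebra.

Set Implicit Arguments.
Unset Strict Implicit.
Unset Printing Implicit Defensive.

(** * The Penalized Knapsack Problem *)

Record pkp (n : nat) := Pkp {
  profit : n.-tuple nat;
  weight : n.-tuple nat;
  penalty : n.-tuple nat;
  capacity : nat }.

Definition feasible (n : nat) (K : pkp n) (x : {ffun 'I_n -> bool}) : bool :=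
  \sum_(j < n) tnth (weight K) j * x j <= capacity K.

(* The objective may be negative, hence the subtraction in [int]; an empty
   [\max] of natural numbers is 0. *)
Definition objective (n : nat) (K : pkp n) (x : {ffun 'I_n -> bool}) : int :=
  (Posz (\sum_(j < n) tnth (profit K) j * x j)
   - Posz (\max_(j < n | x j) tnth (penalty K) j))%R.

Definition optimal (n : nat) (K : pkp n) (x : {ffun 'I_n -> bool}) : Prop :=
  feasible K x /\
  forall y : {ffun 'I_n -> bool},
    feasible K y -> (objective K y <= objective K x)%R.

(** * Unit-cost random access machines

    Registers and memory cells hold natural numbers. A program mentions
    finitely many registers; memory is addressed through register contents.
    Addition and truncated subtraction are the only arithmetic operations, and
    each executed instruction takes one unit of time. *)

Inductive instr :=
  | Const (r k : nat)       (* R[r] := k *)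
  | Add (r s t : nat)       (* R[r] := R[s] + R[t] *)
  | Sub (r s t : nat)       (* R[r] := R[s] - R[t], truncated at 0 *)
  | Fetch (r s : nat)       (* R[r] := M[R[s]] *)
  | Store (r s : nat)       (* M[R[r]] := R[s] *)
  | Jump (l : nat)          (* pc := l *)
  | JumpLt (r s l : nat).   (* if R[r] < R[s] then pc := l *)

Definition program := seq instr.

Record state := State { pc : nat; reg : nat -> nat; mem : nat -> nat }.

Definition upd (f : nat -> nat) (a v : nat) : nat -> nat :=
  fun b => if b == a then v else f b.

Definition exec (i : instr) (s : state) : state :=
  let: State l R M := s in
  match i with
  | Const a k => State l.+1 (upd R a k) M
  | Add a b c => State l.+1 (upd R a (R b + R c)) M
  | Sub a b c => State l.+1 (upd R a (R b - R c)) M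
  | Fetch a b => State l.+1 (upd R a (M (R b))) M
  | Store a b => State l.+1 R (upd M (R a) (R b))
  | Jump l' => State l' R M
  | JumpLt a b l' => State (if R a < R b then l' else l.+1) R M
  end.

Definition halted (P : program) (s : state) : bool := size P <= pc s.

(* Halted states are fixed points. *)
Definition step (P : program) (s : state) : state :=
  if onth P (pc s) is Some i then exec i s else s.

Definition halts_within (P : program) (s : state) (t : nat) (s' : state) :=
  iter t (step P) s = s' /\ halted P s'.

(** * Solving the problem on a machine *)

(* R[0] = n, R[1] = c; the memory holds p_0 .. p_(n-1), w_0 .. w_(n-1),
   pi_0 .. pi_(n-1); everything else is 0. *)
Definition input (n : nat) (K : pkp n) : state :=
  State 0
    (nth 0 [:: n; capacity K])
    (nth 0 (profit K ++ weight K ++ penalty K)).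

(* The solution vector is written right after the input data. *)
Definition outputs (n : nat) (s : state) (x : {ffun 'I_n -> bool}) : Prop :=
  forall j : 'I_n, mem s (3 * n + j) = x j.

(* [P] solves every instance to optimality within [T n c] steps, where [n] is
   the number of items and [c] the capacity. *)
Definition solves_pkp (P : program) (T : nat -> nat -> nat) : Prop :=
  forall (n : nat) (K : pkp n),
  exists (t : nat) (s : state) (x : {ffun 'I_n -> bool}),
    [/\ t <= T n (capacity K), halts_within P (input K) t s,
        outputs s x & optimal K x].

(* Main.v *)
Require Import Defs.
From mathcomp Require Import all_boot all_order all_algebra zify.

Set Implicit Arguments.
Unset Strict Implicit.
Unset Printing Implicit Defensive.

(** Process the items in order of non-decreasing penalty. An optimal solution
    whose last item in this order is the m-th is then a best knapsack over the
    first m items, and conversely a best knapsack over the first m items pays a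
    penalty of at most that of the m-th item. Hence the optimum is the maximum
    over m of (best profit over the first m items) - (m-th penalty), the empty
    prefix counting 0. Bottom-up merge sort orders the items in O(n log n), the
    rows of the knapsack table take O(c) each, and walking back through the
    table from the best prefix recovers the solution.

    The machine program is compiled from a structured language. Its weakest
    preconditions carry a budget of time credits, so that correctness and
    running time are established by the same invariants. *)

(** * A structured language over the machine *)

Inductive cmd :=
  | Do (i : instr)
  | Seq (a b : cmd)
  | If (r s : nat) (a b : cmd)
  | While (r s : nat) (a : cmd).

Notation "a ;; b" := (Seq a b) (at level 90, right associativity).
Coercion Do : instr >-> cmd.

Fixpoint compile (l : nat) (a : cmd) : program :=
  match a with
  | Do i => [:: i]
  | Seq a b => let A := compile l a in A ++ compile (l + size A) b
  | If r s a b =>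
      let B := compile l.+1 b in
      let l1 := (l.+1 + size B).+1 in
      let A := compile l1 a in
      JumpLt r s l1 :: B ++ Jump (l1 + size A) :: A
  | While r s a =>
      let A := compile l.+2 a in
      JumpLt r s l.+2 :: Jump (l.+2 + size A).+1 :: A ++ [:: Jump l]
  end.

Definition assertion := (nat -> nat) -> (nat -> nat) -> nat -> Prop.

(* A copy of [upd] for registers, which unfolds under simplification: register
   names are numerals, whereas memory addresses are symbolic. *)
Definition rset (R : nat -> nat) (r v q : nat) := if q == r then v else R q.
Arguments rset _ _ _ _ /.

(* The last argument of an assertion is the budget of time credits that is left.
   Loops need no termination measure, since each iteration consumes credits. *)
Fixpoint wp (a : cmd) (Q : assertion) : assertion := fun R M k =>
  match a with
  | Do i => 0 < k /\
      match i with
      | Const r v => Q (rset R r v) M k.-1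
      | Add r s t => Q (rset R r (R s + R t)) M k.-1
      | Defs.Sub r s t => Q (rset R r (R s - R t)) M k.-1
      | Fetch r s => Q (rset R r (M (R s))) M k.-1
      | Store r s => Q R (upd M (R r) (R s)) k.-1
      | _ => False
      end
  | Seq a b => wp a (wp b Q) R M k
  | If r s a b => 1 < k /\
      if R r < R s then wp a Q R M k.-2 else wp b Q R M k.-2
  | While r s a => exists I : assertion, I R M k /\
      forall R M k, I R M k -> 1 < k /\
        if R r < R s then wp a I R M k.-2 else Q R M k.-2
  end.

Lemma wp_seq (a b : cmd) (Q : assertion) R M k :
  wp a (wp b Q) R M k -> wp (a ;; b) Q R M k.
Proof. by []. Qed.

Lemma wp_while (r s : nat) (a : cmd) (I Q : assertion) R M k :
  I R M k ->
  (forall R M k, I R M k -> 1 < k /\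
     if R r < R s then wp a I R M k.-2 else Q R M k.-2) ->
  wp (While r s a) Q R M k.
Proof. by exists I. Qed.

(** * Soundness of compilation, with one time credit for each machine step *)

Definition reaches (P : program) (l l' : nat) (Q : assertion) : assertion :=
  fun R M k => exists t R' M' k',
    [/\ t + k' <= k, iter t (step P) (State l R M) = State l' R' M'
      & Q R' M' k'].

Lemma reaches_trans (P : program) (l1 l2 l3 : nat) (Q Q' : assertion) R M k :
  (forall R M k, Q R M k -> reaches P l2 l3 Q' R M k) ->
  reaches P l1 l2 Q R M k -> reaches P l1 l3 Q' R M k.
Proof.
move=> h [t [R1 [M1 [k1 [le1 e1 /h [u [R2 [M2 [k2 [le2 e2 q]]]]]]]]]].
exists (u + t), R2, M2, k2; split=> //; first lia.
by rewrite iterD e1.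
Qed.

Lemma reaches_step (P : program) (i : instr) (l l1 l2 : nat) (Q : assertion)
    R M R1 M1 k k1 :
  onth P l = Some i -> exec i (State l R M) = State l1 R1 M1 -> k1 < k ->
  reaches P l1 l2 Q R1 M1 k1 -> reaches P l l2 Q R M k.
Proof.
move=> hi he lt [t [R2 [M2 [k2 [le2 e2 q]]]]].
exists t.+1, R2, M2, k2; split=> //; first lia.
by rewrite iterSr {2}/step [pc _]/= hi he.
Qed.

Lemma reaches_refl (P : program) (l : nat) (Q : assertion) R M k k' :
  k' <= k -> Q R M k' -> reaches P l l Q R M k.
Proof. by exists 0, R, M, k'. Qed.

Definition code_at (P : program) (l : nat) (A : program) :=
  forall q i, onth A q = Some i -> onth P (l + q) = Some i.

Lemma code_at_cons (P : program) (l : nat) i (A : program) :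
  code_at P l (i :: A) -> onth P l = Some i /\ code_at P l.+1 A.
Proof.
move=> h; split; first by have := h 0 i erefl; rewrite addn0.
by move=> q j e; have := h q.+1 j e; rewrite addnS.
Qed.

Lemma code_at_cat (P : program) (l : nat) (A B : program) :
  code_at P l (A ++ B) -> code_at P l A /\ code_at P (l + size A) B.
Proof.
elim: A l => [|i A IH] l /=; first by rewrite addn0; split=> //; case.
move=> /code_at_cons [hi /IH [hA hB]]; split; last by rewrite addnS -addSn.
by case=> [|q] j /= e; [rewrite addn0 hi | rewrite addnS -addSn; apply: hA].
Qed.

(** Induction on the command. Since [reaches] bounds the time by an inequality, credits may be
    wasted: [wp] charges two for any conditional, although only the else branch, which ends with a
    jump, executes two extra instructions. *)
Lemma compile_sound (P : program) (a : cmd) (l : nat) (Q : assertion) R M k :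
  code_at P l (compile l a) -> wp a Q R M k ->
  reaches P l (l + size (compile l a)) Q R M k.
Proof.
elim: a l Q R M k => [i|a IHa b IHb|r s a IHa b IHb|r s a IHa] l Q R M k /=.
- move=> /code_at_cons [hi _] [k0]; rewrite addn1.
  by case: i hi => // *; (apply: reaches_step; [eassumption | reflexivity | |
    by apply: reaches_refl; [exact: leqnn | eassumption]]); lia.
- move=> /code_at_cat [hA hB] h; rewrite size_cat addnA.
  by apply: reaches_trans (IHa _ _ _ _ _ hA h) => *; apply: IHb.
- move=> /code_at_cons [hi /code_at_cat [hB /code_at_cons [hj hA]]] [k1 h].
  have [lt|ge] := boolP (R r < R s).
    rewrite lt in h.
    apply: (reaches_step (k1 := k.-2) hi); [by rewrite /= lt | lia |].
    have := IHa _ _ _ _ _ hA h.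
    by rewrite size_cat /= !addnS !addSn addnA.
  rewrite (negPf ge) in h.
  apply: (reaches_step (k1 := k.-1) hi); [by rewrite /= (negPf ge) | lia |].
  have [t [R1 [M1 [k2 [le2 e2 q]]]]] := IHb _ _ _ _ _ hB h.
  (* The else branch runs with one credit more than [wp] grants it; this credit pays for the jump
     over the then branch. *)
  have : reaches P l.+1 (l.+1 + size (compile l.+1 b))
    (fun R M k => 0 < k /\ Q R M k.-1) R M k.-1.
    by exists t, R1, M1, k2.+1; split=> //; lia.
  apply: reaches_trans => R2 M2 k3 [k30 q3].
  apply: (reaches_step (k1 := k3.-1) hj); [by [] | lia |].
  rewrite size_cat /= !addnS !addSn addnA.
  exact: reaches_refl q3.
- move=> /code_at_cons [hi /code_at_cons [hj /code_at_cat [hA]]].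
  move=> /code_at_cons [hl _] [I [Ik HI]].
  (* Each iteration pays for its test and its jump back, so strong induction on the budget handles
     the loop. *)
  elim/ltn_ind: k R M Ik => k IH R M Ik.
  have [k1 h] := HI _ _ _ Ik.
  have [lt|ge] := boolP (R r < R s).
    rewrite lt in h.
    apply: (reaches_step (k1 := k.-1) hi); [by rewrite /= lt | lia |].
    have [t [R1 [M1 [k2 [le2 e2 q]]]]] := IHa _ _ _ _ _ hA h.
    have : reaches P l.+2 (l.+2 + size (compile l.+2 a))
      (fun R M m => 0 < m < k /\ I R M m.-1) R M k.-1.
      by exists t, R1, M1, k2.+1; split=> //; [lia | split=> //; lia].
    apply: reaches_trans => R2 M2 k3 [/andP [k30 k3k] q3].
    apply: (reaches_step (k1 := k3.-1) hl); [by [] | lia |].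
    by apply: IH => //; lia.
  rewrite (negPf ge) in h.
  apply: (reaches_step (k1 := k.-1) hi); [by rewrite /= (negPf ge) | lia |].
  apply: (reaches_step (k1 := k.-2) hj); [by [] | lia |].
  rewrite size_cat /= !addnS !addSn addn0.
  exact: reaches_refl h.
Qed.

(** * Register frames and lists stored in memory *)

Definition frame (l : seq nat) (R R' : nat -> nat) :=
  forall r, r \notin l -> R' r = R r.

Lemma frame_rset (l : seq nat) (R R' : nat -> nat) r v :
  r \in l -> frame l R R' -> frame l R (rset R' r v).
Proof.
move=> rl h q ql /=; case: eqP => [e|_]; last exact: h.
by rewrite e rl in ql.
Qed.

Definition holds (M : nat -> nat) (a : nat) (s : seq nat) :=
  forall q, q < size s -> M (a + q) = nth 0 s q.

Lemma holds_cons M a x s :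
  holds M a (x :: s) <-> M a = x /\ holds M a.+1 s.
Proof.
split=> [h|[hx h] [|q] lt]; last by rewrite addnS -addSn h.
  split=> [|q lt]; first by rewrite -[a]addn0 h.
  by rewrite addSn -addnS h.
by rewrite addn0.
Qed.

Lemma holds_cat M a s1 s2 :
  holds M a (s1 ++ s2) <-> holds M a s1 /\ holds M (a + size s1) s2.
Proof.
elim: s1 a => [|x s IH] a /=; first by rewrite addn0; split=> [|[]].
by rewrite !holds_cons IH addnS addSn; tauto.
Qed.

Lemma eq_holds M M' a s :
  (forall b, a <= b < a + size s -> M' b = M b) -> holds M a s -> holds M' a s.
Proof. by move=> e h q lt; rewrite e ?h //; lia. Qed.

Lemma upd_other (f : nat -> nat) a v b : b <> a -> upd f a v b = f b.
Proof. by rewrite /upd; case: eqP. Qed.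

Lemma upd_same (f : nat -> nat) a v : upd f a v a = v.
Proof. by rewrite /upd eqxx. Qed.

(** * Merge sort by penalty *)

(* Constants: [rN] = n, [rC] = c, [r1] = 1, [rZ] = 0, [rT] = 2n. The current list
   of items lies in [rA, rE); a merge takes the runs [rI, rMid) and [rJ, rHi) to
   [rO, rX). *)
Notation rN := 0. Notation rC := 1. Notation r1 := 2. Notation rZ := 3.
Notation rT := 4. Notation rA := 5. Notation rE := 6. Notation rW := 7.
Notation rI := 8. Notation rJ := 9. Notation rMid := 10. Notation rHi := 11.
Notation rO := 12. Notation rX := 13. Notation rU := 14. Notation rV := 15.
Notation rKU := 16. Notation rKV := 17.

Definition take_from (r : nat) : cmd :=
  Fetch rU r ;; Store rO rU ;; Add r r r1 ;; Add rO rO r1.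

Definition merge_loop : cmd :=
  While rO rX
    (If rI rMid
       (If rJ rHi
          (Fetch rU rI ;; Add rKU rT rU ;; Fetch rKU rKU ;;
           Fetch rV rJ ;; Add rKV rT rV ;; Fetch rKV rKV ;;
           If rKV rKU (take_from rJ) (take_from rI))
          (take_from rI))
       (take_from rJ)).

Section MergeLoop.
Variables (n : nat) (M0 : nat -> nat).

Definition penalty_le (i j : nat) := M0 (2 * n + i) <= M0 (2 * n + j).

(** Invariant: the output [o] followed by the merge of the remaining runs is the merge of the
    initial runs. The output lies above both runs and above the penalties, so nothing still to be
    read is overwritten. Ties go to the left run, as in [merge]. *)
Lemma merge_loop_wp (s1 s2 : seq nat) (Q : assertion) R M k :
  (forall a, a < 4 * n -> M a = M0 a) -> R r1 = 1 -> R rT = 2 * n ->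
  all (gtn n) (s1 ++ s2) ->
  holds M (R rI) s1 -> R rI + size s1 = R rMid ->
  holds M (R rJ) s2 -> R rJ + size s2 = R rHi ->
  R rX = R rO + size s1 + size s2 ->
  4 * n <= R rO -> R rMid <= R rO -> R rHi <= R rO ->
  30 * (size s1 + size s2) + 2 <= k ->
  (forall R' M' k',
     frame [:: rI; rJ; rO; rU; rV; rKU; rKV] R R' -> R' rO = R rX ->
     holds M' (R rO) (merge penalty_le s1 s2) ->
     (forall a, a < R rO \/ R rX <= a -> M' a = M a) ->
     k <= k' + 30 * (size s1 + size s2) + 2 -> Q R' M' k') ->
  wp merge_loop Q R M k.
Proof.
move=> MM0 R1 RT s12n h1 e1 h2 e2 eX le0 le1 le2 hk post.
pose I : assertion := fun R' M' k' => exists t1 t2 o,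
  [/\ frame [:: rI; rJ; rO; rU; rV; rKU; rKV] R R',
      all (gtn n) (t1 ++ t2),
      o ++ merge penalty_le t1 t2 = merge penalty_le s1 s2,
      [/\ holds M' (R' rI) t1, R' rI + size t1 = R rMid,
          holds M' (R' rJ) t2 & R' rJ + size t2 = R rHi]
    & [/\ R' rO = R rO + size o, R rX = R' rO + size t1 + size t2,
          holds M' (R rO) o,
          (forall a, a < R rO \/ R rX <= a -> M' a = M a)
        & k <= k' + 30 * size o /\ 30 * (size t1 + size t2) + 2 <= k']].
apply: (@wp_while _ _ _ I).
  by exists s1, s2, [::]; split=> //; split=> //=; lia.
move=> {hk} R' M' k' [t1 [t2 [o [fr tn em [g1 f1 g2 f2] [eO eX' ho mm [hk hk']]]]]].
have frX := fr rX isT; have frM := fr rMid isT; have frH := fr rHi isT.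
have fr1 := fr r1 isT; have frT := fr rT isT.
split; first lia.
case: ltnP => [lt|ge]; last first.
  have z1 : t1 = [::] by apply: size0nil; lia.
  have z2 : t2 = [::] by apply: size0nil; lia.
  move: em; rewrite z1 z2 /= cats0 => em.
  apply: post => //; [lia | by rewrite -em | ].
  have : size o = size s1 + size s2 by rewrite em size_merge size_cat.
  by lia.
(* One output step from the left run, shared by all branches that lead to it; [j] counts the credits
   already spent on tests and fetches. *)
have stepI x t1' R'' j : t1 = x :: t1' ->
    merge penalty_le t1 t2 = x :: merge penalty_le t1' t2 ->
    frame [:: rU; rV; rKU; rKV] R' R'' -> j <= 20 ->
    wp (take_from rI) I R'' M' (k' - j).
  move=> et em' fr' hj.
  move: g1 f1 eX' hk' tn; rewrite et => /holds_cons [gx g1] /= f1 eX' hk' tn.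
  have frI := fr' rI isT; have frJ := fr' rJ isT; have frO := fr' rO isT.
  have fr1' := fr' r1 isT.
  do 4 (split; first lia).
  exists t1', t2, (rcons o x); split.
  - do 3 (apply: frame_rset => //).
    move=> r rl; rewrite fr' ?fr //.
    by move: rl; rewrite !inE !negb_or => /and5P [_ _ _ -> /and3P [-> -> ->]].
  - by case/andP: tn.
  - by rewrite cat_rcons -em' em.
  - rewrite /= frI frJ frO fr1' fr1 R1; split; try lia.
    + rewrite addn1; apply: eq_holds g1 => b hb; rewrite upd_other //; lia.
    + apply: eq_holds g2 => b hb; rewrite upd_other //; lia.
  rewrite /= frI frO fr1' fr1 R1 size_rcons; split; try lia.
  - rewrite -cats1; apply/holds_cat; split.
      apply: eq_holds ho => b hb; rewrite upd_other //; lia.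
    by apply/holds_cons; split=> //; rewrite -eO upd_same gx.
  - move=> a ha; rewrite upd_other ?mm //; lia.
have stepJ x t2' R'' j : t2 = x :: t2' ->
    merge penalty_le t1 t2 = x :: merge penalty_le t1 t2' ->
    frame [:: rU; rV; rKU; rKV] R' R'' -> j <= 20 ->
    wp (take_from rJ) I R'' M' (k' - j).
  move=> et em' fr' hj.
  move: g2 f2 eX' hk' tn; rewrite et => /holds_cons [gx g2] /= f2 eX' hk' tn.
  have frI := fr' rI isT; have frJ := fr' rJ isT; have frO := fr' rO isT.
  have fr1' := fr' r1 isT.
  do 4 (split; first lia).
  exists t1, t2', (rcons o x); split.
  - do 3 (apply: frame_rset => //).
    move=> r rl; rewrite fr' ?fr //.
    by move: rl; rewrite !inE !negb_or => /and5P [_ _ _ -> /and3P [-> -> ->]].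
  - by move: tn; rewrite !all_cat /= => /and3P [-> _ ->].
  - by rewrite cat_rcons -em' em.
  - rewrite /= frI frJ frO fr1' fr1 R1; split; try lia.
    + apply: eq_holds g1 => b hb; rewrite upd_other //; lia.
    + rewrite addn1; apply: eq_holds g2 => b hb; rewrite upd_other //; lia.
  rewrite /= frJ frO fr1' fr1 R1 size_rcons; split; try lia.
  - rewrite -cats1; apply/holds_cat; split.
      apply: eq_holds ho => b hb; rewrite upd_other //; lia.
    by apply/holds_cons; split=> //; rewrite -eO upd_same gx.
  - move=> a ha; rewrite upd_other ?mm //; lia.
have fr0 : frame [:: rU; rV; rKU; rKV] R' R' by [].
rewrite /=; split; first lia.
rewrite frM; case: ltnP => [lt1|ge1]; last first.
  have z1 : t1 = [::] by apply: size0nil; lia.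
  case e : t2 => [|x t2']; first by move: eX'; rewrite z1 e /=; lia.
  have -> : k'.-2.-2 = k' - 4 by lia.
  by apply: (stepJ x t2' R' 4 e) => //; rewrite z1 e.
split; first lia.
rewrite frH; case: ltnP => [lt2|ge2]; last first.
  have z2 : t2 = [::] by apply: size0nil; lia.
  case e : t1 => [|x t1']; first by move: eX'; rewrite z2 e /=; lia.
  have -> : k'.-2.-2.-2 = k' - 6 by lia.
  by apply: (stepI x t1' R' 6 e) => //; rewrite z2 e; case: (t1').
do 7 (split; first lia).
case E1 : t1 => [|x t1']; first by move: f1; rewrite E1 /=; lia.
case E2 : t2 => [|y t2']; first by move: f2; rewrite E2 /=; lia.
move: (g1) (g2); rewrite E1 E2 => /holds_cons [Ex _] /holds_cons [Ey _].
move: (tn); rewrite E1 E2 all_cat /= => /and3P [/andP [xn _] yn _].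
have mem_key z : z < n -> M' (2 * n + z) = M0 (2 * n + z).
  by move=> zn; rewrite mm ?MM0 //; lia.
have -> : k'.-2.-2.-2.-2.-2.-2.-2 = k' - 14 by lia.
set R'' := rset (rset _ 17 _) 17 _.
have fr2 : frame [:: rU; rV; rKU; rKV] R' R''.
  by do 6 (apply: frame_rset => //).
case: ltnP => lt3; rewrite Ex Ey frT RT !mem_key // in lt3.
  apply: (stepJ y t2' R'' 14 E2) => //.
  by rewrite E1 E2 /= {1}/penalty_le leqNgt lt3.
apply: (stepI x t1' R'' 14 E1) => //.
by rewrite E1 E2 /= {1}/penalty_le lt3.
Qed.
End MergeLoop.

(** The last runs may be cut short by the end of the list. Adding the zero register serves as a copy
    and, in the other branch, as a no-op. *)
Definition clamp (r : nat) : cmd := If rE r (Add r rE rZ) (Add r r rZ).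

Lemma clamp_wp (r : nat) (Q : assertion) R M k :
  2 < k -> R rZ = 0 -> Q (rset R r (minn (R r) (R rE))) M (k - 3) ->
  wp (clamp r) Q R M k.
Proof.
move=> hk RZ h /=; rewrite RZ !addn0 /minn in h *; split; first lia.
rewrite !subnS subn0 in h.
have [lt|le] := ltnP (R rE) (R r); last first.
  split; first lia.
  move: h; case: ltnP => // ge; have -> // : R rE = R r by lia.
by move: h; rewrite ltnNge (ltnW lt) /=; split=> //; lia.
Qed.

(** The output list starts at [rE], which is [n] cells above [rA]. Hence the output of two runs
    ending at [rHi] ends at [rHi] plus [n], which is the value given to [rX]. *)
Definition merge_pass : cmd :=
  Add rI rA rZ ;; Add rO rE rZ ;;
  While rI rE
    (Add rMid rI rW ;; clamp rMid ;; Add rHi rMid rW ;; clamp rHi ;;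
     Add rJ rMid rZ ;; Add rX rHi rN ;; merge_loop ;; Add rI rHi rZ) ;;
  Add rA rE rZ ;; Add rE rO rZ ;; Add rW rW rW.

Section MergePass.
Variables (n c : nat) (M0 : nat -> nat).
Local Notation leP := (penalty_le n M0).

Definition blocks_sorted (w : nat) (s : seq nat) :=
  forall q, sorted leP (take w (drop (q * w) s)).

Lemma blocks_sorted_drop w s : blocks_sorted w s -> blocks_sorted w (drop w s).
Proof. by move=> h q; rewrite drop_drop -mulSnr. Qed.

Lemma blocks_sorted_take w s : blocks_sorted w s -> sorted leP (take w s).
Proof. by move=> /(_ 0); rewrite drop0. Qed.

(** Either [s] is a full block, and the later blocks are those of [r], or [s] is short and nothing
    follows it. *)
Lemma blocks_sorted_cat w s r :
  sorted leP s -> size s <= w -> (size s < w -> r = [::]) ->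
  blocks_sorted w r -> blocks_sorted w (s ++ r).
Proof.
move=> ss le hr h q.
have [e|lt] : size s = w \/ size s < w by lia.
  case: q => [|q]; first by rewrite mul0n drop0 take_size_cat.
  by rewrite mulSnr -drop_drop drop_size_cat.
rewrite hr // cats0; case: q => [|q]; first by rewrite drop0 take_oversize.
rewrite drop_oversize // mulSn; lia.
Qed.

(* One level of bottom-up merge sort: items [s] at addresses
   [R rA, ..., R rE - 1], in sorted runs of length [R rW]; the memory above is
   still blank. *)
Definition level (s : seq nat) (R M : nat -> nat) :=
  [/\ [/\ R rN = n, R rC = c, R r1 = 1, R rZ = 0 & R rT = 2 * n],
      [/\ 4 * n <= R rA, R rE = R rA + n & 0 < R rW],
      perm_eq s (iota 0 n),
      blocks_sorted (R rW) s
    & [/\ holds M (R rA) s, forall a, a < 4 * n -> M a = M0 a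
        & forall a, R rE <= a -> M a = 0]].

(** Of the 50 credits per item, 30 pay for the merging itself and the rest for the overhead of each
    pair of runs. *)
Lemma merge_pass_wp (s : seq nat) (Q : assertion) R M k :
  level s R M -> 50 * n + 10 <= k ->
  (forall s' R' M' k', level s' R' M' -> R' rW = 2 * R rW ->
     k <= k' + 50 * n + 10 -> Q R' M' k') ->
  wp merge_pass Q R M k.
Proof.
move=> [[RN RC R1 RZ RT] [le4 eE w0] ps bs [hs M4 Mz]] hk post.
have sizes : size s = n by rewrite (perm_size ps) size_iota.
(* That [o] ends on a block boundary, unless no input remains, is expressed by what may be appended
   to it. At the end, appending the empty list gives the sorted blocks of length [2 * R rW]. *)
pose I : assertion := fun R' M' k' => exists t o : seq nat,
  [/\ frame (iota 8 10) R R',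
      perm_eq (o ++ t) (iota 0 n),
      [/\ R' rI + size t = R rE, holds M' (R' rI) t & blocks_sorted (R rW) t],
      [/\ R' rO = R rE + size o, holds M' (R rE) o,
          forall a, a < R rE -> M' a = M a & forall a, R' rO <= a -> M' a = 0]
    & [/\ forall r, size r <= size t -> blocks_sorted (2 * R rW) r ->
            blocks_sorted (2 * R rW) (o ++ r),
          k <= k' + 50 * size o + 2 & 50 * size t + 8 <= k']].
do 2 (split; first lia).
apply: wp_seq; apply: (@wp_while _ _ _ I).
  exists s, [::]; split=> //=.
  - by do 2 apply: frame_rset => //.
  - by split=> //; rewrite ?RZ ?addn0 ?sizes.
  - by split=> //; rewrite RZ ?addn0.
  - by split=> //; lia.
move=> {hk} R' M' k' [t [o [fr pt [eI ht bt] [eO ho mm mz] [bo hk hk']]]].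
have [frN frC fr1 frZ] : [/\ R' rN = R rN, R' rC = R rC, R' r1 = R r1
  & R' rZ = R rZ] by split; apply: fr.
have [frT frA frE frW] : [/\ R' rT = R rT, R' rA = R rA, R' rE = R rE
  & R' rW = R rW] by split; apply: fr.
have frX := (frN, frC, fr1, frZ, (frT, frA, frE, frW)).
have sizeot : size o + size t = n by rewrite -size_cat (perm_size pt) size_iota.
split; first lia.
rewrite frE; case: ltnP => [lt|ge]; last first.
  have z : t = [::] by apply: size0nil; lia.
  move: pt sizeot; rewrite z cats0 addn0 => pt sizeot.
  rewrite /=; do 3 (split; first lia).
  have w2 : R rW + R rW = 2 * R rW by lia.
  apply: (post o); rewrite /= ?frX ?RZ ?addn0 //; [|lia..].
  split=> //=; rewrite ?frX ?RZ ?addn0 //.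
  - split; lia.
  - by rewrite w2 -[o]cats0; apply: bo => // q; case: q.
  - by split=> // a ha; rewrite mm ?M4 //; lia.
set w := R rW in w0 bs bt bo *.
set t1 := take w t; set t2 := take w (drop w t).
have s1 : size t1 = minn w (size t) by rewrite size_take_min.
have s2 : size t2 = minn w (size t - w) by rewrite size_take_min size_drop.
have s12 : size t1 + size t2 <= size t by lia.
have s3 : size (drop (2 * w) t) = size t - size t1 - size t2.
  by rewrite size_drop; lia.
have et : t = t1 ++ t2 ++ drop (2 * w) t.
  by rewrite mul2n -addnn -drop_drop !cat_take_drop.
apply: wp_seq; split; first lia.
apply: wp_seq; apply: clamp_wp; [lia | by rewrite /= frX |].
apply: wp_seq; split; first lia.
apply: wp_seq; apply: clamp_wp; [lia | by rewrite /= frX |].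
do 2 (apply: wp_seq; split; first lia).
move: (ht); rewrite [X in holds _ _ X]et => /holds_cat [h1 /holds_cat [h2 h3]].
have eMid : minn (R' 8 + w) (R 6) = R' 8 + size t1 by lia.
have eHi : minn (R' 8 + size t1 + w) (R 6) = R' 8 + size t1 + size t2.
  by lia.
(* Every iteration consumes an item, whose 20 spare credits cover the constant overhead. *)
have t1_gt0 : 0 < size t1 by lia.
have le2w : size t1 + size t2 <= 2 * w by lia.
have short : size t1 + size t2 < 2 * w -> size t - size t1 - size t2 = 0 by lia.
clear s1 s2.
apply: wp_seq; apply: (@merge_loop_wp n M0 t1 t2); rewrite /= ?frX //.
all: rewrite ?RZ ?RN ?addn0 -/w ?eMid ?eHi //; try lia.
- by move=> a ha; rewrite mm ?M4 //; lia.
- apply/allP => x xt; have : x \in o ++ t.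
    by rewrite mem_cat et catA [in X in _ || X]mem_cat xt orbT.
  by rewrite (perm_mem pt) mem_iota.
move=> R'' M'' k'' fr'' eO'' ho'' mm'' hk''.
have {}hk'' : k' <= k'' + 30 * (size t1 + size t2) + 14 by lia.
clear eMid eHi.
have pm := permEl (perm_merge leP t1 t2).
have sm : size (merge leP t1 t2) = size t1 + size t2.
  by rewrite (perm_size pm) size_cat.
split; first lia.
exists (drop (2 * w) t), (o ++ merge leP t1 t2); split.
- apply: frame_rset => // r rl.
  have rl' : r < 8 \/ 17 < r by move: rl; rewrite mem_iota; clear; lia.
  have /fr'' -> : r \notin [:: 8; 9; 12; 14; 15; 16; 17].
    by rewrite !inE; move: rl'; clear; lia.
  rewrite /=; do 4 (case: eqP => [er|_]; first by move: rl'; rewrite er => -[]).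
  exact: fr.
- apply: perm_trans pt; rewrite -catA perm_cat2l [X in perm_eq _ X]et catA.
  by rewrite perm_cat2r.
- have -> /= : R'' 11 + R'' 3 = R' 8 + size t1 + size t2.
    by rewrite !fr'' //= frX RZ addn0.
  split.
  + by rewrite s3; lia.
  + by apply: eq_holds h3 => a ha; rewrite mm'' //; lia.
  + by rewrite mul2n -addnn -drop_drop; do 2 apply: blocks_sorted_drop.
- split; rewrite /= ?size_cat ?sm.
  + by lia.
  + apply/holds_cat; split; last by rewrite -eO.
    by apply: eq_holds ho => a ha; rewrite mm'' //; lia.
  + by move=> a ha; rewrite mm'' ?mm //; lia.
  + by move=> a ha; rewrite mm'' ?mz //; lia.
- split; last 2 first.
  + rewrite size_cat sm; lia.
  + rewrite s3; lia.
  move=> r sr br; rewrite -catA; apply: bo.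
    by rewrite size_cat sm; lia.
  apply: blocks_sorted_cat => //; rewrite ?sm;
    last by move=> *; apply: size0nil; lia.
  + apply: merge_sorted; first by move=> x y; apply: leq_total.
      exact: blocks_sorted_take.
    by apply: blocks_sorted_take; apply: blocks_sorted_drop.
  + by lia.
Qed.

End MergePass.

(** The list starts at [4 * n]: the input occupies the first [3 * n] cells, and the next [n] are
    reserved for the solution. *)
Definition sort_items : cmd :=
  Const r1 1 ;; Const rZ 0 ;; Add rT rN rN ;; Add rA rT rT ;; Add rE rA rZ ;;
  Const rI 0 ;; Const rW 1 ;;
  While rI rN (Store rE rI ;; Add rI rI r1 ;; Add rE rE r1) ;;
  While rW rN merge_pass.

Section SortItems.
Variables (n c : nat) (M0 : nat -> nat).
Hypothesis M0_blank : forall a, 3 * n <= a -> M0 a = 0.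

Definition sort_time := (trunc_log 2 n).+1 * (50 * n + 12) + 10 * n + 15.

Lemma sort_items_wp (Q : assertion) R k :
  R rN = n -> R rC = c -> sort_time <= k ->
  (forall s R' M' k', level n c M0 s R' M' -> sorted (penalty_le n M0) s ->
     k <= k' + sort_time -> Q R' M' k') ->
  wp sort_items Q R M0 k.
Proof.
move=> RN RC; rewrite /sort_time; set T := trunc_log _ _ => hk post.
do 7 (split; first lia).
set R0 := rset _ rW _.
have [z0 z1 z2 z3 z4] : [/\ R0 rN = n, R0 rC = c, R0 r1 = 1, R0 rZ = 0
  & R0 rT = 2 * n] by rewrite /R0 /= RN; split=> //; lia.
have [z5 z6 z7 z8] : [/\ R0 rA = 4 * n, R0 rE = 4 * n, R0 rW = 1 & R0 rI = 0].
  by rewrite /R0 /= RN; split=> //; lia.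
rewrite [(k.-1.-2.-2.-2)](_ : _ = k - 7); last lia.
clearbody R0.
pose I : assertion := fun R' M' k' => exists i,
  [/\ frame [:: rE; rI] R0 R', i <= n, R' rI = i /\ R' rE = 4 * n + i,
      holds M' (4 * n) (iota 0 i) & [/\ forall a, a < 4 * n -> M' a = M0 a,
       forall a, 4 * n + i <= a -> M' a = 0
        & k <= k' + 7 + 5 * i /\ T.+1 * (50 * n + 12) + 10 * (n - i) + 8 <= k']].
apply: wp_seq; apply: (@wp_while _ _ _ I).
  exists 0; split=> //=; first by split; lia.
  by split=> // [a ha|]; [apply: M0_blank | ]; lia.
move=> R' M' k' [i [fr le [eI eE] hi [m4 mz [hk1 hk2]]]].
split; first lia.
have frN : R' rN = n by rewrite fr.
rewrite eI frN; case: ltnP => [lt|ge].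
  rewrite /=; do 3 (split; first lia).
  exists i.+1; split=> //=.
  - by do 2 apply: frame_rset => //.
  - by rewrite eI eE (fr r1) // z2 !addn1 addnS.
  - have -> : 0 :: iota 1 i = iota 0 i ++ [:: i] by rewrite -(iotaD 0 i 1) addn1.
    apply/holds_cat; split.
      by apply: eq_holds hi => a; rewrite size_iota => ha;
        rewrite upd_other //; lia.
    by apply/holds_cons; rewrite size_iota -eE upd_same eI.
  - split=> [a ha|a ha|]; last lia; rewrite upd_other;
      [exact: m4|lia|apply: mz|]; lia.
have ei : i = n by lia.
rewrite ei in eE hi mz hk1 hk2 => {ei ge le eI hk}.
have hlev : level n c M0 (iota 0 n) R' M'.
  split=> //=; rewrite ?eE //.
  - by split; rewrite fr.
  - by rewrite (fr rA) // (fr rW) // z5 z7; split; lia.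
  - by rewrite (fr rW) // z7 => q; case: (drop _ _) => //= x l; rewrite take0.
  - by split=> //; rewrite fr // z5.
(* [f] bounds the number of passes left: each pass doubles the run length. It starts at [T.+1]
   because [n < 2 ^ T.+1], and at 0 the loop test must fail. *)
pose J : assertion := fun R' M' k' => exists s f,
  [/\ level n c M0 s R' M', n <= R' rW * 2 ^ f,
      k <= k' + 9 + 5 * n + (T.+1 - f) * (50 * n + 12) &
      f * (50 * n + 12) + 2 <= k' /\ f <= T.+1].
apply: (@wp_while _ _ _ J).
  exists (iota 0 n), T.+1; split=> //.
  - by rewrite (fr rW) // z7 mul1n ltnW // trunc_log_ltn.
  - by rewrite subnn; lia.
  - split=> //; lia.
move=> {hlev fr eE hi m4 mz hk1 hk2 frN} R'' M'' k'' [s [f [hl hf hk1 [hk2 fT]]]].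
have [[RN' _ _ _ _] [_ _ w0] ps bs _] := hl.
have sizes : size s = n by rewrite (perm_size ps) size_iota.
split; first lia.
rewrite RN'; case: ltnP => [lt|ge].
  case: f hf hk1 hk2 fT => [|f] hf hk1 hk2 fT.
    by move: hf; rewrite muln1; lia.
  rewrite mulSn in hk2.
  apply: (merge_pass_wp hl); first lia.
  move=> s' R3 M3 k3 hl3 w3 hk3.
  exists s', f; split=> //.
  - by rewrite w3 -mulnA mulnCA -expnS mulnC mulnC.
  - have -> : T.+1 - f = (T.+1 - f.+1).+1 by lia.
    by rewrite mulSn; lia.
  - by split; lia.
(* The run length has reached [n], so the first block is the whole list. *)
apply: (post s) => //.
  by have := bs 0; rewrite drop0 take_oversize // sizes.
have : (T.+1 - f) * (50 * n + 12) <= T.+1 * (50 * n + 12).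
  by rewrite leq_mul2r; lia.
lia.
Qed.
End SortItems.

(** * Knapsacks over prefixes of a list of items *)

Section Knapsack.
Variables p w : nat -> nat.

Fixpoint knap (r : seq nat) (d : nat) : nat :=
  if r is x :: r' then
    if w x <= d then maxn (knap r' d) (p x + knap r' (d - w x)) else knap r' d
  else 0.

(** The test compares entries of two neighbouring table rows, which is what [backtrack] can read. A
    strict increase implies [w x <= d], so the subtraction is exact. *)
Fixpoint knap_set (r : seq nat) (d : nat) : seq nat :=
  if r is x :: r' then
    if knap r' d < knap r d then x :: knap_set r' (d - w x) else knap_set r' d
  else [::].

Lemma knap_ge (r : seq nat) (d : nat) (y : nat -> bool) :
  \sum_(i <- r) w i * y i <= d -> \sum_(i <- r) p i * y i <= knap r d.
Proof.
elim: r d => [|x r IH] d; first by rewrite !big_nil.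
rewrite !big_cons /=; case: (y x); rewrite ?muln1 ?muln0 ?add0n.
  move=> h; rewrite (leq_trans (leq_addr _ _) h).
  have /IH h' : \sum_(i <- r) w i * y i <= d - w x by lia.
  by lia.
by move=> /IH h; case: (w x <= d) => //; rewrite leq_max h.
Qed.

Lemma knap_set_sub (r : seq nat) (d : nat) : {subset knap_set r d <= r}.
Proof.
elim: r d => [|x r IH] d i //=; rewrite inE; case: ifP => _.
  by rewrite inE => /orP [-> //|/IH ->]; rewrite orbT.
by move/IH ->; rewrite orbT.
Qed.

(** The sums select items by membership, so [uniq] prevents a chosen head from being counted again
    in the tail. *)
Lemma knap_set_sum (r : seq nat) (d : nat) : uniq r ->
  \sum_(i <- r) w i * (i \in knap_set r d) <= d /\
  \sum_(i <- r) p i * (i \in knap_set r d) = knap r d.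
Proof.
elim: r d => [|x r IH] d; first by rewrite !big_nil.
move=> /= /andP [xr ur]; rewrite !big_cons.
set k := if w x <= d then _ else _.
have notin d' : x \in knap_set r d' = false.
  by apply: contraNF xr => /knap_set_sub.
case: ifP => [lt|_ge]; last first.
  have [h1 h2] := IH d ur; rewrite notin !muln0 !add0n; split=> //.
  by move: _ge; rewrite h2 /k; case: ifP => // _; lia.
move: lt; rewrite /k; case: ifP => [le lt|_]; last by rewrite ltnn.
have [h1 h2] := IH (d - w x) ur; rewrite mem_head !muln1.
have ext F : \sum_(i <- r) F i * (i \in x :: knap_set r (d - w x)) =
    \sum_(i <- r) F i * (i \in knap_set r (d - w x)).
  apply: eq_big_seq => i ir; rewrite inE; case: eqP => // e.
  by rewrite -e ir in xr.
by rewrite !ext h2; split; lia.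
Qed.
End Knapsack.

(** Here [m] is one past the last position where [y] holds, or 0 if there is none. It delimits the
    shortest prefix containing a given solution. *)
Lemma last_true (s : seq nat) (y : nat -> bool) :
  exists m, [/\ m <= size s, forall i, i \in drop m s -> y i = false
    & 0 < m -> y (nth 0 s m.-1)].
Proof.
elim/last_ind: s => [|s x [m [le h1 h2]]]; first by exists 0.
case yx : (y x).
  exists (size s).+1; rewrite size_rcons; split=> // [i|_].
    by rewrite drop_oversize // size_rcons.
  by rewrite nth_rcons ltnn eqxx.
exists m; rewrite size_rcons; split; first exact: leqW.
  move=> i; rewrite -cats1 drop_cat; case: ltnP => _.
    by rewrite mem_cat inE => /orP [/h1|/eqP ->].
  by move/mem_drop; rewrite inE => /eqP ->.
by move=> m0; rewrite nth_rcons; case: ltnP; [rewrite h2 | lia].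
Qed.

(** [knap] recurses on the head, whereas a new table row adds an item at the end of the prefix;
    hence [rev]. *)
Definition prefix_profit (p w : nat -> nat) (c : nat) (s : seq nat) (m : nat) :=
  knap p w (rev (take m s)) c.

Definition prefix_penalty (q : nat -> nat) (s : seq nat) (m : nat) :=
  if m is m'.+1 then q (nth 0 s m') else 0.

(** Maximality at [m] of profit minus penalty; the penalties change sides to avoid truncated
    subtraction. *)
Definition best_prefix (p w q : nat -> nat) (c : nat) (s : seq nat) (j m : nat) :=
  forall i, i <= j -> prefix_profit p w c s i + prefix_penalty q s m <=
    prefix_profit p w c s m + prefix_penalty q s i.

(** * Optimality of the best prefix *)

Section Prefixes.
Variables (n : nat) (K : pkp n) (s : seq nat) (p w q : nat -> nat).
Hypothesis profitE : forall j : 'I_n, p j = tnth (profit K) j.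
Hypothesis weightE : forall j : 'I_n, w j = tnth (weight K) j.
Hypothesis penaltyE : forall j : 'I_n, q j = tnth (penalty K) j.
Hypothesis perm_s : perm_eq s (iota 0 n).
Hypothesis sorted_s : sorted (fun i j => q i <= q j) s.
Let c := capacity K.

Lemma sum_items (F : nat -> nat) (y : nat -> bool) (t : n.-tuple nat)
    (x : {ffun 'I_n -> bool}) :
  (forall j : 'I_n, F j = tnth t j) -> (forall j : 'I_n, x j = y j) ->
  \sum_(j < n) tnth t j * x j = \sum_(i <- s) F i * y i.
Proof.
move=> eF ex; rewrite (perm_big _ perm_s) /= -[X in iota 0 X]subn0.
rewrite -/(index_iota 0 n) big_mkord; apply: eq_bigr => j _.
by rewrite -eF ex.
Qed.

(** A competitor [y] is compared with the prefix that ends at its last item: this prefix has at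
    least the profit of [y] and its last item costs at most the penalty of [y]. *)
Lemma prefix_optimal (m : nat) :
  m <= n -> best_prefix p w q c s n m ->
  optimal K [ffun j : 'I_n => val j \in knap_set p w (rev (take m s)) c].
Proof.
move=> mn hm; set X := knap_set _ _ _ _; set x := [ffun j => _].
have us : uniq s by rewrite (perm_uniq perm_s) iota_uniq.
have sizes : size s = n by rewrite (perm_size perm_s) size_iota.
have sumD F (y : nat -> bool) j : (forall i, i \in drop j s -> y i = false) ->
    \sum_(i <- s) F i * y i = \sum_(i <- rev (take j s)) F i * y i.
  move=> h; rewrite -{1}(cat_take_drop j s) big_cat /= [X in _ + X]big1_seq ?addn0.
    by apply: perm_big; rewrite perm_sym perm_rev.
  by move=> i /andP [_ /h ->]; rewrite muln0.
have ur : uniq (rev (take m s)) by rewrite rev_uniq take_uniq.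
have [Xw Xp] := @knap_set_sum p w _ c ur.
have Xm i : i \in X -> i \in take m s by move/knap_set_sub; rewrite mem_rev.
have Xd i : i \in drop m s -> (i \in X) = false.
  move=> id; apply/negP => /Xm it; move: us; rewrite -{1}(cat_take_drop m s).
  by rewrite cat_uniq => /and3P [_ /hasPn /(_ _ id)]; rewrite /= it.
have ex (j : 'I_n) : x j = (val j \in X) by rewrite ffunE.
split=> [|y].
  rewrite /feasible (@sum_items w (fun i => i \in X)) //.
  by rewrite (sumD w _ m).
(* [y] is extended by [false] to all natural numbers, to be summed over the list [s]. *)
pose Y i := oapp y false (insub i).
have eY (j : 'I_n) : y j = Y j by rewrite /Y valK.
rewrite /feasible /objective.
rewrite (sum_items (F := w) _ eY) // (sum_items (F := p) _ eY) //.
rewrite (sum_items (F := p) _ ex) // (sumD p (fun i => i \in X) m) // Xp => fY.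
have [j [jn Yd Yj]] := last_true s Y.
rewrite sizes in jn; have /= hj := hm j jn.
have lY : \sum_(i <- s) p i * Y i <= prefix_profit p w c s j.
  by rewrite (sumD p Y j) //; apply: knap_ge; rewrite -(sumD w Y j).
have penY : prefix_penalty q s j <= \max_(i < n | y i) tnth (penalty K) i.
  case: j jn Yj {Yd hj lY} => // j jn /(_ isT) /= Yj.
  have ltn : nth 0 s j < n.
    have : nth 0 s j \in s by rewrite mem_nth ?sizes.
    by rewrite (perm_mem perm_s) mem_iota.
  rewrite (penaltyE (Ordinal ltn)).
  by apply: (leq_bigmax_cond (Ordinal ltn)); rewrite eY.
(* Only here does the order matter: every chosen item stands no later than the end of the prefix. *)
have penX : \max_(i < n | x i) tnth (penalty K) i <= prefix_penalty q s m.
  apply/bigmax_leqP => i; rewrite ex => /Xm.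
  rewrite -penaltyE => it.
  have /(nthP 0) [u] := it.
  rewrite size_take sizes => hu eu.
  have um : u < m by move: hu; case: ifP; lia.
  have <- : nth 0 s u = i :> nat by rewrite -eu nth_take.
  case: (m) um mn => // m' um m'n /=.
  have tr : transitive (fun i j => q i <= q j) by move=> a b d; apply: leq_trans.
  have rf : reflexive (fun i j => q i <= q j) by move=> a; apply: leqnn.
  by apply: (sorted_leq_nth tr rf 0 sorted_s); rewrite ?inE ?sizes; lia.
rewrite -/(prefix_profit p w c s m); move: hj lY penY penX; clear.
move: (\sum_(_ <- s) _) (\max_(_ < n | y _) _) (\max_(_ < n | x _) _).
by move=> a b d; lia.
Qed.
End Prefixes.

(** * The knapsack table and the reconstruction *)

(* These reuse the registers of the merge sort from [rI] on. [rBV], [rBP], [rBI]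
   and [rBRow] describe the best prefix so far: its profit, its last penalty, its
   end in the list of items and its row in the table. *)
Notation rRow := 9. Notation rL := 10. Notation rD := 11. Notation rS := 13.
Notation rItem := 14. Notation rP := 15. Notation rWt := 16. Notation rPi := 17.
Notation rBV := 18. Notation rBP := 19. Notation rBI := 20. Notation rBRow := 21.
Notation rF := 22. Notation rG := 23.

(** [rS] runs along the previous row and [rO] one row ahead. If the item fits, the cell [rWt] places
    before [rS] is in the same row, at the reduced capacity. *)
Definition fill_row : cmd :=
  While rD rL
    (Fetch rF rS ;;
     If rD rWt (Add rF rF rZ)
       (Defs.Sub rG rS rWt ;; Fetch rG rG ;; Add rG rG rP ;;
        If rF rG (Add rF rG rZ) (Add rF rF rZ)) ;;
     Store rO rF ;; Add rD rD r1 ;; Add rS rS r1 ;; Add rO rO r1).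

Definition fill_table : cmd :=
  Add rI rA rZ ;; Add rRow rE rZ ;; Add rL rC r1 ;;
  Const rBV 0 ;; Const rBP 0 ;; Add rBI rA rZ ;; Add rBRow rE rZ ;;
  While rI rE
    (Fetch rItem rI ;; Fetch rP rItem ;; Add rWt rN rItem ;; Fetch rWt rWt ;;
     Add rPi rT rItem ;; Fetch rPi rPi ;;
     Const rD 0 ;; Add rS rRow rZ ;; Add rO rRow rL ;; fill_row ;;
     Add rRow rS rZ ;; Add rI rI r1 ;; Add rF rRow rC ;; Fetch rF rF ;;
     Add rG rBV rPi ;; Add rO rF rBP ;;
     If rG rO
       (Add rBV rF rZ ;; Add rBP rPi rZ ;; Add rBI rI rZ ;; Add rBRow rRow rZ)
       (Add rG rG rZ)).

Definition backtrack : cmd :=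
  Add rD rC rZ ;; Add rO rT rN ;;
  While rA rBI
    (Defs.Sub rBI rBI r1 ;; Add rF rBRow rD ;; Fetch rF rF ;;
     Defs.Sub rBRow rBRow rL ;; Add rG rBRow rD ;; Fetch rG rG ;;
     If rG rF
       (Fetch rItem rBI ;; Add rWt rN rItem ;; Fetch rWt rWt ;;
        Defs.Sub rD rD rWt ;; Add rItem rO rItem ;; Store rItem r1)
       (Add rG rG rZ)).

Lemma fill_row_wp (p w : nat -> nat) (c x : nat) (r : seq nat) (Q : assertion)
    R M k :
  [/\ R r1 = 1, R rZ = 0, R rD = 0 & R rL = c.+1] ->
  [/\ R rP = p x, R rWt = w x & R rO = R rS + c.+1] ->
  (forall d, d <= c -> M (R rS + d) = knap p w r d) ->
  20 * c.+1 + 2 <= k ->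
  (forall R' M' k', frame [:: rD; rO; rS; rF; rG] R R' -> R' rS = R rO ->
     (forall d, d <= c -> M' (R rO + d) = knap p w (x :: r) d) ->
     (forall a, a < R rO -> M' a = M a) ->
     k <= k' + 20 * c.+1 + 2 -> Q R' M' k') ->
  wp fill_row Q R M k.
Proof.
move=> [R1 RZ RD RL] [RP RW RO] hM hk post.
pose I : assertion := fun R' M' k' => exists d,
  [/\ frame [:: rD; rO; rS; rF; rG] R R', d <= c.+1,
      [/\ R' rD = d, R' rO = R rO + d & R' rS = R rS + d],
      (forall e, e < d -> M' (R rO + e) = knap p w (x :: r) e)
    & [/\ forall a, a < R rO -> M' a = M a, k <= k' + 20 * d
        & 20 * (c.+1 - d) + 2 <= k']].
apply: (@wp_while _ _ _ I).
  by exists 0; split=> //; [split; lia | split=> //; lia].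
move=> {hk} R' M' k' [d [fr le [eD eO eS] hM' [mm hk hk']]].
split; first lia.
have frL := fr rL isT; have frZ := fr rZ isT; have frW := fr rWt isT.
have fr1 := fr r1 isT; have frP := fr rP isT.
rewrite eD frL RL; case: ltnP => [lt|ge]; last first.
  have ed : d = c.+1 by lia.
  by apply: post => //; rewrite ?ed in hM' *; [lia | move=> *; apply: hM' | lia].
(* The common tail of the three branches, once [rF] holds the new entry; [j] counts the credits
   spent before it. *)
have stepd R'' j : frame [:: rF; rG] R' R'' -> j <= 12 ->
    R'' rF = knap p w (x :: r) d ->
    wp (Store rO rF ;; Add rD rD r1 ;; Add rS rS r1 ;; Add rO rO r1)
      I R'' M' (k' - j).
  move=> fr' hj eF; do 4 (split; first lia).
  exists d.+1; rewrite /= (fr' rD) // (fr' rO) // (fr' rS) // (fr' r1) // fr1 R1.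
  split=> //; last split.
  - do 3 (apply: frame_rset => //).
    move=> q ql; rewrite fr' ?fr //.
    by move: ql; rewrite !inE !negb_or => /and5P [_ _ _ -> ->].
  - by split; lia.
  - move=> e; rewrite ltnS leq_eqVlt => /orP [/eqP ->|lte].
      by rewrite eO upd_same.
    by rewrite upd_other ?hM' //; lia.
  - by move=> a ha; rewrite upd_other ?mm //; lia.
  - by lia.
  - by lia.
have row e : e <= d -> M' (R rS + e) = knap p w r e.
  by move=> hd; rewrite mm ?hM //; lia.
apply: wp_seq; split; first lia.
apply: wp_seq; split; first lia.
have -> : rset R' rF (M' (R' rS)) rD = d by [].
have -> : rset R' rF (M' (R' rS)) rWt = w x by rewrite /= frW.
case: ltnP => [ltw|gew].
  split; first lia.
  have -> : k'.-2.-1.-2.-1 = k' - 6 by lia.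
  apply: stepd => //=; first by do 2 apply: frame_rset => //.
  by rewrite eS row // frZ RZ addn0 leqNgt ltw.
do 3 (apply: wp_seq; split; first lia).
split; first lia.
set R'' := rset _ rG _.
have eF : R'' rF = knap p w r d by rewrite /R'' /= eS row.
have eG : R'' rG = p x + knap p w r (d - w x).
  rewrite /R'' /= eS frW frP RW RP addnC -addnBA // row //; lia.
have eZ : R'' rZ = 0 by rewrite /R'' /= frZ.
have fr'' : frame [:: rF; rG] R' R'' by do 4 (apply: frame_rset => //).
clearbody R''; rewrite eF eG.
case: ltnP => [ltk|gek]; (split; first lia).
  have -> : k'.-2.-1.-2.-1.-2.-2.-1 = k' - 11 by lia.
  apply: stepd => //; first by apply: frame_rset.
  by rewrite /= eG eZ gew; lia.
have -> : k'.-2.-1.-2.-1.-2.-2.-1 = k' - 11 by lia.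
apply: stepd => //; first by apply: frame_rset.
by rewrite /= eF eZ gew; lia.
Qed.

(** * Correctness and cost of filling the table *)

Section Table.
Variables (n c : nat) (M0 : nat -> nat).
Let p i := M0 i.
Let w i := M0 (n + i).
Let q i := M0 (2 * n + i).

Definition table_at (D : nat) (s : seq nat) (j : nat) (M : nat -> nat) :=
  forall i d, i <= j -> d <= c ->
    M (D + i * c.+1 + d) = knap p w (rev (take i s)) d.

(** The invariant pairs the rows up to [j] with the best prefix among the first [j]. The last entry
    of each new row is the profit of its prefix, and cross sums compare it with the best one so
    far. *)
Lemma fill_table_wp (s : seq nat) (Q : assertion) R M k :
  level n c M0 s R M -> n * (20 * c + 60) + 10 <= k ->
  (forall m R' M' k', m <= n -> best_prefix p w q c s n m ->
     frame (iota 8 16) R R' ->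
     [/\ R' rL = c.+1, R' rBI = R rA + m & R' rBRow = R rE + m * c.+1] ->
     table_at (R rE) s n M' -> (forall a, a < R rE -> M' a = M a) ->
     k <= k' + n * (20 * c + 60) + 10 -> Q R' M' k') ->
  wp fill_table Q R M k.
Proof.
move=> [[RN RC R1 RZ RT] [le4 eE _] ps _ [hs M4 Mz]] hk post.
have sizes : size s = n by rewrite (perm_size ps) size_iota.
set T := 20 * c + 60 in hk post.
have hT : T = 20 * c + 60 by []. clearbody T.
pose I : assertion := fun R' M' k' => exists j m,
  [/\ frame (iota 8 16) R R', m <= j <= n /\ best_prefix p w q c s j m,
      [/\ R' rI = R rA + j, R' rRow = R rE + j * c.+1, R' rL = c.+1,
          R' rBI = R rA + m & R' rBRow = R rE + m * c.+1],
      R' rBV = prefix_profit p w c s m /\ R' rBP = prefix_penalty q s m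
    & [/\ table_at (R rE) s j M', forall a, a < R rE -> M' a = M a,
          k <= k' + 7 + j * T & (n - j) * T + 2 <= k']].
do 7 (split; first lia).
apply: (@wp_while _ _ _ I).
  exists 0, 0; split=> //=.
  - by do 7 apply: frame_rset => //.
  - by split=> // i; rewrite leqn0 => /eqP ->.
  - by rewrite !RZ RC R1 mul0n !addn0 addn1.
  - by rewrite /prefix_profit take0.
  (* Row 0 is the blank memory above the sorted list: the empty prefix has profit 0 at every
     capacity. *)
  - split=> // [i d||]; [|lia..].
    by rewrite leqn0 => /eqP -> ld /=; rewrite take0 Mz //; lia.
move=> {hk} R' M' k' [j [m [fr [/andP [mj jn] bp] [eI eRow eL eBI eBRow] [eBV eBP]
  [tab mm hk hk']]]].
have [frN frC fr1 frZ] : [/\ R' rN = n, R' rC = c, R' r1 = 1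
  & R' rZ = 0] by rewrite !fr.
have [frT frA frE] : [/\ R' rT = 2 * n, R' rA = R rA & R' rE = R rE] by rewrite !fr.
split; first by apply: leq_trans hk'; rewrite addn2.
rewrite frE eI; case: ltnP => [lt|ge]; last first.
  have ej : j = n by lia.
  by rewrite ej in bp tab hk; apply: (post m) => //; lia.
have {}lt : j < n by lia.
have ejn : n - j = (n - j.+1).+1 by lia.
have [V eV] : exists V, V = (n - j.+1) * T by eexists.
rewrite ejn mulSn -eV in hk'.
set x := nth 0 s j.
have xn : x < n.
  have : x \in s by rewrite mem_nth ?sizes.
  by rewrite (perm_mem ps) mem_iota.
have Mx : M' (R rA + j) = x by rewrite mm ?hs ?sizes //; lia.
have low a : a < 4 * n -> M' a = M0 a by move=> ha; rewrite mm ?M4 //; lia.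
have takeS : rev (take j.+1 s) = x :: rev (take j s).
  by rewrite (take_nth 0) ?sizes // rev_rcons.
do 9 (apply: wp_seq; split; first lia).
set R1' := rset _ rO _.
have fr1' : frame (iota 8 16) R' R1' by do 9 (apply: frame_rset => //).
have [g1 g2 g3] : [/\ R1' rItem = x, R1' rP = p x & R1' rWt = w x].
  by rewrite /R1' /= eI Mx frN; split=> //; rewrite low //; lia.
have [g4 g5 g6 g7] : [/\ R1' rPi = q x, R1' rD = 0, R1' rS = R' rRow
    & R1' rO = R' rRow + c.+1].
  by rewrite /R1' /= eI Mx frT frZ eL addn0; split=> //; rewrite low //; lia.
have [g8 g9 gA gB] : [/\ R1' rI = R' rI, R1' rBV = R' rBV, R1' rBP = R' rBP
    & R1' rBI = R' rBI] by [].
have [gC gD gE gF] : [/\ R1' rBRow = R' rBRow, R1' rL = c.+1, R1' r1 = 1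
    & R1' rZ = 0] by [].
have gG : R1' rC = c by [].
clearbody R1'.
apply: wp_seq; apply: (fill_row_wp (p := p) (w := w) (c := c) (x := x)
  (r := rev (take j s))); rewrite ?g6 //; [|lia|].
  by move=> d ld; rewrite eRow tab.
move=> R2 M2 k2 fr2 eS2 row2 mm2 hk2.
rewrite g7 in eS2 row2 mm2.
do 6 (apply: wp_seq; split; first lia).
set R3 := rset _ rO _.
have fr3 : frame (iota 8 16) R R3.
  do 6 (apply: frame_rset => //).
  move=> r rl; have rl' : r < 8 \/ 23 < r by move: rl; rewrite mem_iota; clear; lia.
  rewrite fr2; last by rewrite !inE; move: rl'; clear; lia.
  by rewrite fr1' ?fr.
have [h1 h2 h3] : [/\ R3 rRow = R rE + j.+1 * c.+1, R3 rI = R rA + j.+1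
    & R3 rF = prefix_profit p w c s j.+1].
  rewrite /R3 /= eS2 !(fr2 rZ) // gF (fr2 rI) // g8 eI (fr2 r1) // gE.
  rewrite (fr2 rC) // gG addn0 row2 // eRow -takeS mulSn; split=> //; lia.
have [h4 h5] : R3 rG = prefix_profit p w c s m + prefix_penalty q s j.+1 /\
    R3 rO = prefix_profit p w c s j.+1 + prefix_penalty q s m.
  rewrite -h3 /R3 /= (fr2 rBV) // (fr2 rPi) // (fr2 rBP) // g9 g4 gA eBV eBP.
  by [].
have [h6 h7 h8 h9] : [/\ R3 rPi = q x, R3 rZ = 0, R3 rL = c.+1
    & R3 rBI = R rA + m].
  by rewrite /R3 /= !fr2 // gB.
have [hA hB hC] : [/\ R3 rBRow = R rE + m * c.+1, R3 rBV = prefix_profit p w c s m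
    & R3 rBP = prefix_penalty q s m].
  by rewrite /R3 /= !fr2 // gC g9 gA.
clearbody R3.
have tab2 : table_at (R rE) s j.+1 M2.
  move=> i d; rewrite leq_eqVlt => /orP [/eqP ->|lti] ld.
    by rewrite takeS -row2 // eRow mulSn; congr (M2 _); lia.
  rewrite mm2 ?tab // eRow.
  have : i * c.+1 <= j * c.+1 by rewrite leq_mul2r; lia.
  lia.
have mm2' a : a < R rE -> M2 a = M a.
  by move=> ha; rewrite mm2 ?mm // eRow; lia.
have hk12 : 12 <= k2 by lia.
split; first by move: hk12; clear; lia.
have exitI R4 m' k4 : frame (iota 8 16) R R4 -> m' <= j.+1 ->
    best_prefix p w q c s j.+1 m' ->
    [/\ R4 rI = R3 rI, R4 rRow = R3 rRow, R4 rL = R3 rL,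
        R4 rBI = R rA + m' & R4 rBRow = R rE + m' * c.+1] ->
    R4 rBV = prefix_profit p w c s m' -> R4 rBP = prefix_penalty q s m' ->
    k2 <= k4 + 12 -> I R4 M2 k4.
  move=> fr4 lem' bp' [i1 i2 i3 i4 i5] i6 i7 hk4.
  exists j.+1, m'; split=> //; first by rewrite lem' lt.
    by rewrite i1 i2 i3 h1 h2 h8.
  by split=> //; rewrite ?mulSn -?eV; lia.
rewrite h4 h5; case: ltnP => [ltb|geb].
  do 4 (split; first by move: hk12; clear; lia).
  apply: (exitI _ j.+1); rewrite /= ?h7 ?addn0 //; last by move: hk12; clear; lia.
    by do 4 (apply: frame_rset => //).
  move=> i; rewrite leq_eqVlt => /orP [/eqP -> //|lti].
  (* The new prefix beats prefix [m], which was best so far, hence all earlier ones. *)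
  have := bp i lti; lia.
split; first by move: hk12; clear; lia.
apply: (exitI _ m); rewrite /= ?h7 ?addn0 //; [|by apply: leqW| |];
  last by move: hk12; clear; lia.
  by apply: frame_rset.
move=> i; rewrite leq_eqVlt => /orP [/eqP -> //|lti].
exact: bp.
Qed.

End Table.

(** * Recovering the solution from the table *)

Section Backtracking.
Variables (n c : nat) (M0 : nat -> nat).
Hypothesis M0_blank : forall a, 3 * n <= a -> M0 a = 0.
Let p i := M0 i.
Let w i := M0 (n + i).

(** Invariant: the items [S] already marked, together with what [knap_set] takes from the remaining
    prefix at the remaining capacity, form the solution. Only ones are stored; the other output
    cells keep their initial 0. *)
Lemma backtrack_wp (s : seq nat) (m : nat) (Q : assertion) R M k :
  [/\ R rN = n, R rC = c, R r1 = 1, R rZ = 0 & R rT = 2 * n] ->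
  [/\ 4 * n <= R rA, R rE = R rA + n, R rL = c.+1, R rBI = R rA + m
    & R rBRow = R rE + m * c.+1] ->
  perm_eq s (iota 0 n) -> m <= n -> holds M (R rA) s ->
  table_at n c M0 (R rE) s n M -> (forall a, a < 4 * n -> M a = M0 a) ->
  20 * n + 10 <= k ->
  (forall (R' M' : nat -> nat) k', (forall j, j < n ->
     M' (3 * n + j) = (j \in knap_set p w (rev (take m s)) c)) -> Q R' M' k') ->
  wp backtrack Q R M k.
Proof.
move=> [RN RC R1 RZ RT] [le4 eE RL RBI RBRow] ps mn hs tab M4 hk post.
have sizes : size s = n by rewrite (perm_size ps) size_iota.
pose I : assertion := fun R' M' k' => exists m' d S,
  [/\ frame [:: rD; rO; rBI; rF; rBRow; rG; rItem; rWt] R R', m' <= m /\ d <= c,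
      [/\ R' rBI = R rA + m', R' rBRow = R rE + m' * c.+1, R' rD = d
        & R' rO = 3 * n],
      S ++ knap_set p w (rev (take m' s)) d =i knap_set p w (rev (take m s)) c
    & [/\ forall a, a < 3 * n \/ 4 * n <= a -> M' a = M a,
          forall j, j < n -> M' (3 * n + j) = (j \in S) & 20 * m' + 2 <= k']].
do 2 (split; first lia).
apply: (@wp_while _ _ _ I).
  exists m, c, [::]; split=> //=.
  - by do 2 apply: frame_rset => //.
  - by split=> //; lia.
  - by split=> // [j jn|]; [rewrite M4 ?M0_blank|]; lia.
move=> {hk} R' M' k' [m' [d [S [fr [lem ld] [eBI eBRow eD eO] eS [mm out hk]]]]].
have [frN frC fr1 frZ] : [/\ R' rN = n, R' rC = c, R' r1 = 1
  & R' rZ = 0] by rewrite !fr.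
have [frA frL] : R' rA = R rA /\ R' rL = c.+1 by rewrite !fr.
split; first lia.
rewrite frA eBI; case: ltnP => [lt|ge]; last first.
  apply: post => j jn; rewrite out // -eS.
  have -> : m' = 0 by lia.
  by rewrite take0 /= cats0.
case: m' lem eBI eBRow eS hk lt => [|m'] lem eBI eBRow eS hk lt; first lia.
set x := nth 0 s m'.
have xn : x < n.
  have : x \in s by rewrite mem_nth ?sizes //; lia.
  by rewrite (perm_mem ps) mem_iota.
(* Marking items writes only below [4 * n], so the table is intact. *)
have tab' i e : i <= n -> e <= c ->
    M' (R rE + i * c.+1 + e) = knap p w (rev (take i s)) e.
  by move=> hi he; rewrite mm ?tab //; lia.
have takeS : rev (take m'.+1 s) = x :: rev (take m' s).
  by rewrite (take_nth 0) ?sizes ?rev_rcons //; lia.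
have eB1 : R rA + m'.+1 - 1 = R rA + m' by lia.
have eR1 : R rE + m'.+1 * c.+1 - c.+1 = R rE + m' * c.+1 by rewrite mulSn; lia.
do 6 (apply: wp_seq; split; first lia).
set R2 := rset _ rG _.
have fr2 : frame [:: rD; rO; rBI; rF; rBRow; rG; rItem; rWt] R R2.
  by do 6 (apply: frame_rset => //).
have [g1 g2 g3 g4] : [/\ R2 rBI = R rA + m', R2 rBRow = R rE + m' * c.+1,
    R2 rD = d & R2 rO = 3 * n].
  by rewrite /R2 /= eBI eBRow fr1 frL.
have [g5 g6] : R2 rF = knap p w (rev (take m'.+1 s)) d /\
    R2 rG = knap p w (rev (take m' s)) d.
  by rewrite /R2 /= eBRow frL eD eR1 !tab' //; lia.
have [g7 g8 g9] : [/\ R2 rN = n, R2 rZ = 0 & R2 r1 = 1] by [].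
clearbody R2.
split; first lia.
rewrite g5 g6; rewrite takeS /= -/(knap p w (x :: _) d) in eS g5 *.
have hk20 : 22 <= k' by lia.
case: ltnP eS => [ltk|gek] eS; last first.
  split; first lia.
  exists m', d, S; rewrite /= g1 g2 g3 g4; split=> //.
  - by apply: frame_rset.
  - by split=> //; lia.
  - by split=> //; lia.
do 6 (apply: wp_seq || idtac; split; first by move: hk20; clear; lia).
have Mx : M' (R rA + m') = x by rewrite mm ?hs ?sizes //; lia.
have Mw : M' (n + x) = w x by rewrite mm ?M4 //; lia.
exists m', (d - w x), (x :: S); rewrite /= g1 g2 g3 g4 g7 g9 Mx Mw; split=> //.
- by do 5 (apply: frame_rset => //).
- by split; lia.
- move=> i; rewrite -eS !(inE, mem_cat); clear; case: (i == x); rewrite ?orbT //.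
- split=> [a ha|j jn|]; last lia.
    by rewrite upd_other ?mm //; lia.
  rewrite inE /upd eqn_add2l; case: eqP => //= _; exact: out.
Qed.
End Backtracking.

(** * Solving the problem *)

Definition pkp_cmd : cmd := sort_items ;; fill_table ;; backtrack.

(** For [2 <= n] the logarithm is positive, so [n * trunc_log 2 n] absorbs the linear terms; the
    successor covers [n = 1]. *)
Lemma time_bound (n c : nat) :
  sort_time n + n * (20 * c + 60) + 20 * n + 20 <=
  1000 * (maxn (n * c) (n * trunc_log 2 n)).+1.
Proof.
have h3 : n <= (n * trunc_log 2 n).+1.
  case: n => [|[|n']] //; apply: leqW; apply: leq_pmulr.
  by rewrite trunc_log_gt0.
have h4 : trunc_log 2 n <= n * trunc_log 2 n.
  by case: n {h3} => [|n'] //; apply: leq_pmull.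
rewrite /sort_time; move: (trunc_log 2 n) h3 h4 => L h3 h4.
have h1 := leq_maxl (n * c) (n * L); have h2 := leq_maxr (n * c) (n * L).
rewrite mulSn mulnDr mulnDr.
have -> : L * (50 * n) = 50 * (n * L) by lia.
have -> : n * (20 * c) = 20 * (n * c) by lia.
lia.
Qed.

(* [trunc_log 2 n] is the integer part of log_2 n. The [.+1] only matters when
   the maximum vanishes (n = 0, or n = 1 and c = 0). *)
Theorem theorem2 :
  exists (P : program) (C : nat),
    solves_pkp P
      (fun n c : nat => C * (maxn (n * c) (n * trunc_log 2 n)).+1).
Proof.
exists (compile 0 pkp_cmd), 1000 => n K.
set c := capacity K; set k := 1000 * _.
have hk : sort_time n + n * (20 * c + 60) + 20 * n + 20 <= k by apply: time_bound.
pose M0 := nth 0 (profit K ++ weight K ++ penalty K).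
pose p i := M0 i; pose w i := M0 (n + i); pose q i := M0 (2 * n + i).
have pE (j : 'I_n) : p j = tnth (profit K) j.
  by rewrite /p /M0 nth_cat size_tuple ltn_ord -tnth_nth.
have wE (j : 'I_n) : w j = tnth (weight K) j.
  rewrite /w /M0 nth_cat size_tuple ltnNge leq_addr /= addKn.
  by rewrite nth_cat size_tuple ltn_ord -tnth_nth.
have qE (j : 'I_n) : q j = tnth (penalty K) j.
  rewrite /q /M0 mul2n -addnn -addnA nth_cat size_tuple ltnNge leq_addr /= addKn.
  by rewrite nth_cat size_tuple ltnNge leq_addr /= addKn -tnth_nth.
(* Beyond the input, [nth] returns its default 0, which is the blank memory. *)
have blank a : 3 * n <= a -> M0 a = 0.
  by move=> ha; rewrite /M0 nth_default // !size_cat !size_tuple; lia.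
pose Post : assertion := fun R' M' k' => exists x : {ffun 'I_n -> bool},
  (forall j : 'I_n, M' (3 * n + j) = x j) /\ optimal K x.
have : wp pkp_cmd Post (nth 0 [:: n; c]) M0 k.
  apply: wp_seq; apply: (sort_items_wp (c := c) blank) => //; first lia.
  move=> s R1 M1 k1 lev ss hk1.
  apply: wp_seq; apply: (fill_table_wp lev); first lia.
  move=> m R2 M2 k2 mn bp fr2 [rL2 rBI2 rBRow2] tab2 mm2 hk2.
  have [[RN RC R1' RZ RT] [le4 eE _] ps _ [hs M4 _]] := lev.
  have sizes : size s = n by rewrite (perm_size ps) size_iota.
  have [frA frE] : R2 rA = R1 rA /\ R2 rE = R1 rE by rewrite !fr2.
  apply: (backtrack_wp (c := c) blank (s := s) (m := m)); rewrite ?frA ?frE //.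
  - by split; rewrite fr2.
  - by apply: eq_holds hs => a; rewrite sizes => ha; apply: mm2; lia.
  - by move=> a ha; rewrite mm2 ?M4 //; lia.
  - by lia.
  move=> R3 M3 k3 out.
  exists [ffun j : 'I_n => val j \in knap_set p w (rev (take m s)) c]; split.
    by move=> j; rewrite ffunE out.
  exact: (prefix_optimal pE wE qE ps ss mn bp).
(* The initial budget [k] is the claimed bound, so soundness bounds the number of steps by it. *)
move/(compile_sound (P := compile 0 pkp_cmd) (l := 0)).
case=> // t [R' [M' [k' [tk run [x [out opt]]]]]].
exists t, (State (size (compile 0 pkp_cmd)) R' M'), x; split=> //.
by lia.
Qed.
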